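(* Let $\mathcal{C}$ be a linear $(n,k,d,r,\delta)$-LRC over the finite field $\mathbb{F}_q$ (that is, an $[n,k,d]$ linear code over $\mathbb{F}_q$ with all-symbol locality $(r,\delta)$, where $r,\delta$ are positive integers). Then $$k \leq \min_{t \in \mathbb{Z}_{+}} \left\{ tr + k_{\mathrm{opt}}^{(q)}\bigl(n-t(r+\delta-1),\, d\bigr) \right\}.$$
   Context: $\mathbb{Z}_+=\{0,1,2,\dots\}$ and $[n]=\{1,\dots,n\}$. An $[n,k,d]$ linear code over $\mathbb{F}_q$ has length $n$, dimension $k\ge 1$ and minimum (Hamming) distance $d$. For $I\subseteq[n]$, $\mathcal{C}|_I=\{\mathbf{c}_I:\mathbf{c}\in\mathcal{C}\}$. The zero code is regarded as having infinite minimum distance. Locality: an $[n,k,d]$ linear code $\mathcal{C}$ has all-symbol locality $(r,\delta)$ if for every $i\in[n]$ there is a set $R\subseteq[n]$ (a repair set) with (1) $i\in R$, (2) $|R|\le r+\delta-1$, (3) the minimum distance of $\mathcal{C}|_R$ is at least $\delta$. $k_{\mathrm{opt}}^{(q)}(m,d)$ is the largest dimension of a linear code over $\mathbb{F}_q$ of length $m$ and minimum distance at least $d$; it equals $0$ if there is no such nonzero code (in particular if $m<d$, including $m\le 0$). *)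

(* Defs.v *)
From HB Require Import structures.
From mathcomp Require Import all_boot all_order all_algebra.

Set Implicit Arguments.
Unset Strict Implicit.
Unset Printing Implicit Defensive.

Import GRing.Theory.
Import VectorInternalTheory.
Local Open Scope ring_scope.

(* A linear code of length n over F is a subspace of 'rV[F]_n; the coordinates
   are indexed by 'I_n = {0, ..., n-1} instead of {1, ..., n}. *)

(* Over a finite field there are finitely many codes of a given length, so
   that a maximum can be taken over all of them. *)
HB.instance Definition _ (F : finFieldType) (n : nat) :=
  [Finite of {vspace 'rV[F]_n} by <:].

Definition hamming_dist (F : finFieldType) (n : nat) (x y : 'rV[F]_n) : nat :=
  #|[set i | x 0 i != y 0 i]|.

(* Holds for every d when C is the zero code, whose minimum distance is
   infinite. *)
Definition min_dist_geq (F : finFieldType) (n : nat) (C : {vspace 'rV[F]_n})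
    (d : nat) : bool :=
  [forall x in C, forall y in C, (x != y) ==> (d <= hamming_dist x y)%N].

(* The minimum distance of C is finite and equal to d. *)
Definition has_min_dist (F : finFieldType) (n : nat) (C : {vspace 'rV[F]_n})
    (d : nat) : bool :=
  min_dist_geq C d &&
  [exists x in C, exists y in C, (x != y) && (hamming_dist x y == d)].

(* C is an [n, k, d] linear code. *)
Definition is_linear_code (F : finFieldType) (n k d : nat)
    (C : {vspace 'rV[F]_n}) : bool :=
  [&& (0 < k)%N, \dim C == k & has_min_dist C d].

(* C|_I, as a code of length #|I|: the coordinates in I are listed in
   increasing order. *)
Definition restrict_code (F : finFieldType) (n : nat) (C : {vspace 'rV[F]_n})
    (I : {set 'I_n}) : {vspace 'rV[F]_#|I|} :=
  (linfun (colsub (fun j : 'I_#|I| => enum_val j)) @: C)%VS.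

Definition is_repair_set (F : finFieldType) (n : nat) (C : {vspace 'rV[F]_n})
    (r delta : nat) (i : 'I_n) (I : {set 'I_n}) : bool :=
  [&& i \in I, (#|I| <= r + delta - 1)%N & min_dist_geq (restrict_code C I) delta].

Definition has_all_symbol_locality (F : finFieldType) (n : nat)
    (C : {vspace 'rV[F]_n}) (r delta : nat) : Prop :=
  forall i : 'I_n, exists I : {set 'I_n}, is_repair_set C r delta i I.

Definition is_LRC (F : finFieldType) (n k d r delta : nat)
    (C : {vspace 'rV[F]_n}) : Prop :=
  is_linear_code k d C /\ has_all_symbol_locality C r delta.

(* The maximum is 0 when only the zero code has minimum distance at least d,
   in particular when m = 0. As k_opt vanishes at length 0, a length computed
   by truncated subtraction of naturals follows the convention that k_opt is 0
   for a length m <= 0. *)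
Definition k_opt (F : finFieldType) (m d : nat) : nat :=
  \max_(C : {vspace 'rV[F]_m} | min_dist_geq C d) \dim C.

Definition is_min (f : nat -> nat) (v : nat) : Prop :=
  (exists t, f t = v) /\ (forall t, v <= f t)%N.

(* Main.v *)
(* For a set S of coordinates let C_S be the subcode of C vanishing on S. By
   induction on t there is a set S with at least min(n, t(r + delta - 1))
   elements such that dim C_S >= k - tr: take S of maximal cardinality for t;
   if a coordinate i is left outside, adding its repair set R to S lowers the
   dimension, so a word of C_S is nonzero on R \ S. A word that vanishes on all
   but delta - 1 coordinates of R vanishes on R, so C_{S u R} is cut out of C_S
   by |R \ S| - delta + 1 coordinates only: the other delta - 1 come for free,
   and r + delta - 1 coordinates can be added at the cost of r dimensions.
   Deleting coordinates of S from C_S then yields a code of length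
   n - t(r + delta - 1) and minimum distance at least d. *)
Require Import Defs.
From mathcomp Require Import all_boot all_order all_algebra zify.

Set Implicit Arguments.
Unset Strict Implicit.
Unset Printing Implicit Defensive.

Import GRing.Theory.
Local Open Scope ring_scope.

Lemma subset_of_card (T : finType) (A : {set T}) (m : nat) :
  (m <= #|A|)%N -> exists2 B : {set T}, B \subset A & #|B| = m.
Proof.
move=> le_mA; exists [set:: take m (enum A)].
  by apply/subsetP => x; rewrite inE => /mem_take; rewrite mem_enum.
rewrite cardsE (card_uniqP _) ?take_uniq ?enum_uniq // size_takel //.
by rewrite -cardE.
Qed.

(** Arguments beyond [f 0] have values larger than [f 0], so the minimum over the finite range
    [t <= f 0] is global. *)
Lemma is_min_exists (f : nat -> nat) :
  (forall t, t <= f t)%N -> exists v, is_min f v.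
Proof.
move=> le_f; case: (@arg_minnP 'I_(f 0%N).+1 ord0 xpredT f) => // i _ min_i.
exists (f i); split=> [|t]; first by exists i.
have [le_tf0 | lt_f0t] := leqP t (f 0%N); first exact: (min_i (Ordinal _)).
by apply: leq_trans (min_i ord0 isT) (leq_trans (ltnW lt_f0t) (le_f t)).
Qed.

Lemma min_dist_geqP (F : finFieldType) (n : nat) (C : {vspace 'rV[F]_n})
    (d : nat) :
  reflect {in C &, forall x y, x != y -> (d <= hamming_dist x y)%N}
    (min_dist_geq C d).
Proof.
apply: (iffP forall_inP) => [hd x y xC yC | hd x xC].
  exact: (implyP (forall_inP (hd x xC) y yC)).
by apply/forall_inP => y yC; apply/implyP; apply: hd.
Qed.

Section Code.

Context (F : finFieldType) (n : nat).
Implicit Types (C : {vspace 'rV[F]_n}) (x y : 'rV[F]_n) (S I : {set 'I_n}).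

Definition puncture S : 'Hom('rV[F]_n, 'rV[F]_#|S|) :=
  linfun (colsub (fun j : 'I_#|S| => enum_val j)).

Lemma punctureE S x j : puncture S x 0 j = x 0 (enum_val j).
Proof. by rewrite lfunE mxE. Qed.

Lemma hamming_dist_puncture S x y :
  hamming_dist (puncture S x) (puncture S y) =
  #|[set i in S | x 0 i != y 0 i]|.
Proof.
rewrite /hamming_dist -(card_imset _ enum_val_inj); apply: eq_card => i.
rewrite inE; apply/imsetP/andP => [[j] | [iS nz]].
  by rewrite inE !punctureE => nz ->; rewrite enum_valP.
exists (enum_rank_in iS i); last by rewrite enum_rankK_in.
by rewrite inE !punctureE enum_rankK_in.
Qed.

(** The zero coordinates are kept, so that shortenings on different sets are subspaces of one space
    and can be iterated and compared. *)
Definition shorten C S : {vspace 'rV[F]_n} := (C :&: lker (puncture S))%VS.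

Lemma shortenP C S x :
  reflect (x \in C /\ {in S, forall i, x 0 i = 0}) (x \in shorten C S).
Proof.
rewrite memv_cap memv_ker; apply: (iffP andP) => -[xC x0]; split=> //.
  move=> i iS; rewrite -(enum_rankK_in iS iS) -punctureE (eqP x0).
  by rewrite mxE.
by apply/eqP/rowP => j; rewrite punctureE mxE x0 ?enum_valP.
Qed.

Lemma shortenU C S I : shorten C (S :|: I) = shorten (shorten C S) I.
Proof.
apply/vspaceP => x; apply/shortenP/shortenP => [[xC x0] | [/shortenP[xC xS] xI]].
  by split; [apply/shortenP; split=> // |] => i iS; rewrite x0 // inE iS ?orbT.
by split=> // i /setUP[/xS | /xI].
Qed.

(** Rank-nullity for [puncture S] on [C]: the image has dimension at most [#|S|]. *)
Lemma dim_shorten C S : (\dim C <= \dim (shorten C S) + #|S|)%N.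
Proof.
rewrite -(limg_ker_dim (puncture S) C) leq_add2l.
by rewrite (leq_trans (dimvS (subvf _))) // dimvf dim_matrix mul1r.
Qed.

Lemma repair_set_weight C I delta x :
    min_dist_geq (restrict_code C I) delta -> x \in C ->
    (exists2 i, i \in I & x 0 i != 0) ->
  (delta <= #|[set i in I | x 0%R i != 0%R]|)%N.
Proof.
move=> /min_dist_geqP hd xC [i iI nz].
have := hd (puncture I x) (puncture I 0).
rewrite !memv_img ?mem0v // hamming_dist_puncture => /(_ isT isT).
have -> : [set j in I | x 0 j != (0 : 'rV_n) 0 j] = [set j in I | x 0 j != 0].
  by apply/setP => j; rewrite !inE mxE.
apply; apply: contraNneq nz => /rowP/(_ (enum_rank_in iI i)).
by rewrite !punctureE enum_rankK_in // mxE => ->.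
Qed.

Lemma shorten_repair_set C S I delta : (0 < delta)%N ->
    min_dist_geq (restrict_code C I) delta ->
    (\dim (shorten C (S :|: I)) < \dim (shorten C S))%N ->
  (\dim (shorten C S) + delta <=
   \dim (shorten C (S :|: I)) + #|I :\: S| + 1)%N.
Proof.
move=> delta_gt0 hd lt_dim.
have /subvPn[x /shortenP[xC xS] xSI] : ~~ (shorten C S <= shorten C (S :|: I))%VS.
  by apply: contraL lt_dim => /dimvS; rewrite -leqNgt.
(* The word [x] is nonzero somewhere on [I], hence in at least [delta] places of [I], all outside
   [S]. *)
have le_delta : (delta <= #|I :\: S|)%N.
  apply: (@leq_trans #|[set i in I | x 0 i != 0]|); last first.
    apply/subset_leq_card/subsetP => i; rewrite !inE => /andP[-> nz].
    by rewrite andbT; apply: contra nz => /xS ->.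
  apply: (repair_set_weight hd xC); apply/exists_inP; apply: contraR xSI.
  rewrite negb_exists_in => /forall_inP x0; apply/shortenP; split=> // i.
  by case/setUP => [/xS // | /x0]; rewrite negbK => /eqP.
(* [A] omits exactly [delta - 1] elements of [I :\: S]: too few to support a word that is nonzero on
   [I]. *)
have [A sAIS cardA] : exists2 A : {set 'I_n},
    A \subset I :\: S & #|A| = (#|I :\: S| - delta.-1)%N.
  by apply: subset_of_card; rewrite leq_subr.
have sub : (shorten C (S :|: A) <= shorten C (S :|: I))%VS.
  apply/subvP => y /shortenP[yC y0]; apply/shortenP; split=> // i.
  case/setUP => [iS | iI]; first by rewrite y0 // inE iS.
  apply/eqP; apply: contraT => nz.
  have := repair_set_weight hd yC (ex_intro2 _ _ i iI nz).
  suff /subset_leq_card : [set i in I | y 0 i != 0] \subset (I :\: S) :\: A.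
    by rewrite cardsD (setIidPr sAIS) cardA; move: #|[set _ in _ | _]| => w; lia.
  apply/subsetP => j; rewrite !inE => /andP[-> nzj]; rewrite andbT -negb_or.
  by apply: contra nzj => jSA; rewrite y0 // inE orbC.
have := dim_shorten (shorten C S) A; rewrite -shortenU cardA.
by have := dimvS sub; lia.
Qed.

Lemma locality_shorten C r delta t : (0 < delta)%N ->
    has_all_symbol_locality C r delta ->
  exists S, (minn n (t * (r + delta - 1)) <= #|S|)%N /\
            (\dim C <= \dim (shorten C S) + t * r)%N.
Proof.
move=> delta_gt0 loc; elim: t => [|t [S0 [leS0 dimS0]]].
  exists set0; split; first by rewrite mul0n minn0.
  by have := dim_shorten C set0; rewrite cards0.
case: (@arg_maxnP _ S0 (fun S => \dim C <= \dim (shorten C S) + t * r)%N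
  (fun S => #|S|) dimS0) => S dimS maxS.
have leS := leq_trans leS0 (maxS S0 dimS0).
have [/eqP ST | /set0Pn[i]] := eqVneq (~: S) set0.
  exists S; split; last by move: dimS; rewrite mulSn; lia.
  by have := cardsCs S; rewrite (eqP ST) cards0 card_ord; lia.
rewrite inE => iS; have [I /and3P[iI cardI hd]] := loc i.
have cardSI : #|S :|: I| = (#|S| + #|I :\: S|)%N.
  by rewrite cardsU cardsD setIC; have := subset_leq_card (subsetIl I S); lia.
(* Otherwise [S :|: I], which also contains [i], would contradict the maximality of [S]. *)
have lt_dim : (\dim (shorten C (S :|: I)) < \dim (shorten C S))%N.
  rewrite ltnNge; apply/negP => le_dim.
  have := maxS (S :|: I); rewrite cardSI.
  have : (0 < #|I :\: S|)%N by apply/card_gt0P; exists i; rewrite inE iS.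
  by lia.
have := shorten_repair_set delta_gt0 hd lt_dim.
have le_IS : (#|I :\: S| <= r + delta - 1)%N.
  exact: leq_trans (subset_leq_card (subsetDl I S)) cardI.
(* [I] may bring fewer than [r + delta - 1] new coordinates. Padding by [E] makes up the difference,
   or exhausts all coordinates, at one dimension at most per element; the total cost stays within
   [r]. *)
have [E sE cardE] := subset_of_card
  (geq_minr (r + delta - 1 - #|I :\: S|)%N #|~: (S :|: I)|).
have := dim_shorten (shorten C (S :|: I)) E; rewrite -shortenU => dimE.
have cardSIE : #|S :|: I :|: E| = (#|S :|: I| + #|E|)%N.
  by rewrite cardsU disjoint_setI0 ?cards0 ?subn0 // disjoints_subset -setCS setCK.
have := cardsC (S :|: I); rewrite card_ord => cardn dimSI.
by exists (S :|: I :|: E); rewrite cardSIE !mulSn; lia.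
Qed.

(** Deleting only [n - m] of the coordinates in [S] gives length exactly [m]; the words of
    [shorten C S] vanish there, so distances and dimension are preserved. *)
Lemma dim_shorten_k_opt C d S m : min_dist_geq C d -> (m <= n)%N ->
  (n - #|S| <= m)%N -> (\dim (shorten C S) <= k_opt F m d)%N.
Proof.
move=> /min_dist_geqP hd le_mn leS.
have cardS : (#|~: S| + #|S| = n)%N by rewrite addnC cardsC card_ord.
have [B sBS cardB] : exists2 B : {set 'I_n}, B \subset S & #|B| = (n - m)%N.
  by apply: subset_of_card; lia.
(* Replacing [m] by [#|~: B|] lets the punctured code have the right type without a cast. *)
have <- : #|~: B| = m by have := cardsC B; rewrite card_ord; lia.
have eq0 x i : x \in shorten C S -> i \in B -> x 0 i = 0.
  by move=> /shortenP[_ x0] iB; rewrite x0 // (subsetP sBS).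
rewrite -(@limg_dim_eq _ _ _ (puncture (~: B))).
  apply: leq_bigmax_cond; apply/min_dist_geqP => x1 y1 /memv_imgP[x xS ->].
  case/memv_imgP => [y yS ->] neq_xy.
  rewrite hamming_dist_puncture.
  have [xC yC] : x \in C /\ y \in C by case/shortenP: xS; case/shortenP: yS.
  have neq : x != y by apply: contraNneq neq_xy => ->.
  apply: leq_trans (hd x y xC yC neq) _; apply/subset_leq_card/subsetP => i.
  rewrite !inE => nz; rewrite nz andbT; apply: contra nz => iB.
  by rewrite !eq0.
apply/eqP; rewrite -subv0; apply/subvP => x /shortenP[xS x0].
rewrite memv0; apply/eqP/rowP => i; rewrite mxE.
by have [iB | iB] := boolP (i \in B); [apply: eq0 | apply: x0; rewrite inE].
Qed.

End Code.

Theorem corollary2 (F : finFieldType) (n k d r delta : nat)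
    (C : {vspace 'rV[F]_n}) (hr : (0 < r)%N) (hdelta : (0 < delta)%N)
    (hC : is_LRC k d r delta C) :
  exists v : nat,
    is_min (fun t : nat => t * r + k_opt F (n - t * (r + delta - 1)) d)%N v /\
    (k <= v)%N.
Proof.
have [/and3P[_ /eqP dimC /andP[hd _]] loc] := hC.
have [t | v minv] := @is_min_exists
  (fun t => t * r + k_opt F (n - t * (r + delta - 1)) d)%N.
  by rewrite (leq_trans _ (leq_addr _ _)) // leq_pmulr.
exists v; split=> //; have [[t <-] _] := minv.
have [S [leS dimS]] := locality_shorten t hdelta loc.
rewrite -dimC addnC (leq_trans dimS) // leq_add2r.
(* If [t * (r + delta - 1)] exceeds [n], then [S] is everything and the truncated length is 0. *)
by apply: dim_shorten_k_opt hd _ _; lia.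
Qed.
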